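(* Let $p(x)=\sum_{i=0}^n a_i x^i$ be a polynomial of degree $n\ge 1$ with floating point coefficients, and let $x$ be a floating point value. Assume that no underflow nor overflow occurs during the computations. If $$\operatorname{cond}(p,x) < \frac{1-\mathbf{u}}{2+\mathbf{u}}\,\mathbf{u}\,\gamma_{2n}^{-2},$$ then $\mathsf{CompHorner}(p,x)$ computes a faithful rounding of the exact value $p(x)$.
   Context: Floating point arithmetic. All computations are performed in one working precision of IEEE-754 binary floating point arithmetic (e.g. double precision) with rounding to the nearest. $\mathbb{F}$ is the set of all normalized floating point numbers, together with $0$. $\mathbf{u}$ is the unit roundoff, i.e. half the spacing between $1$ and the next larger floating point number ($\mathbf{u}=2^{-53}$ in double precision). $\oplus,\ominus,\otimes,\oslash$ are the floating point addition, subtraction, multiplication and division; $\operatorname{fl}(\cdot)$ denotes the result of an expression in which every operation is performed in the working precision. When no underflow nor overflow occurs, for $a,b\in\mathbb{F}$ and $\circ\in\{+,-,\times,/\}$, $\operatorname{fl}(a\circ b)=(a\circ b)(1+\varepsilon_1)=(a\circ b)/(1+\varepsilon_2)$ with $|\varepsilon_1|,|\varepsilon_2|\le\mathbf{u}$. Faithful rounding. For real $r$, $\operatorname{pred}(r)=\max\{f\in\mathbb{F}: f<r\}$ and $\operatorname{succ}(r)=\min\{f\in\mathbb{F}: r<f\}$. A floating point number $f$ is a faithful rounding of a real number $r$ if $\operatorname{pred}(f)<r<\operatorname{succ}(f)$. Constants. For a positive integer $k$, $\gamma_k=\dfrac{k\mathbf{u}}{1-k\mathbf{u}}$; whenever this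 notation is used it is implicitly assumed that $k\mathbf{u}<1$. Condition number. For $p(x)=\sum_{i=0}^n a_i x^i$ with $p(x)\neq 0$, $\operatorname{cond}(p,x)=\dfrac{\sum_{i=0}^n|a_i||x|^i}{|p(x)|}$. Algorithms. - $\mathsf{Horner}(p,x)$, for $p=\sum_{i=0}^n a_i x^i$: $r_n=a_n$; $r_i=(r_{i+1}\otimes x)\oplus a_i$ for $i=n-1,\dots,0$; returns $r_0$. - $[x,y]=\mathsf{TwoSum}(a,b)$: $x=a\oplus b$; $z=x\ominus a$; $y=(a\ominus(x\ominus z))\oplus(b\ominus z)$. It is an error free transformation: $x=a\oplus b$ and $a+b=x+y$ exactly. - $[x,y]=\mathsf{Split}(a)$: $z=a\otimes(2^r+1)$; $x=z\ominus(z\ominus a)$; $y=a\ominus x$ (with $r=27$ in double precision). - $[x,y]=\mathsf{TwoProd}(a,b)$: $x=a\otimes b$; $[a_h,a_l]=\mathsf{Split}(a)$; $[b_h,b_l]=\mathsf{Split}(b)$; $y=a_l\otimes b_l\ominus(((x\ominus a_h\otimes b_h)\ominus a_l\otimes b_h)\ominus a_h\otimes b_l)$. It is an error free transformation: $x=a\otimes b$ and, if no underflow occurs, $a\times b=x+y$ exactly. - $[s_0,p_\pi,p_\sigma]=\mathsf{EFTHorner}(p,x)$: $s_n=a_n$; for $i=n-1,\dots,0$: $[p_i,\pi_i]=\mathsf{TwoProd}(s_{i+1},x)$ and $[s_i,\sigma_i]=\mathsf{TwoSum}(p_i,a_i)$; $p_\pi=\sum_{i=0}^{n-1}\pi_i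 x^i$ and $p_\sigma=\sum_{i=0}^{n-1}\sigma_i x^i$. Here $s_0=\mathsf{Horner}(p,x)$. - $\overline{r}=\mathsf{CompHorner}(p,x)$: $[\widehat{r},p_\pi,p_\sigma]=\mathsf{EFTHorner}(p,x)$; $\widehat{c}=\mathsf{Horner}(p_\pi\oplus p_\sigma,x)$, where $p_\pi\oplus p_\sigma$ is the polynomial with coefficients $\pi_i\oplus\sigma_i$, $0\le i\le n-1$; $\overline{r}=\widehat{r}\oplus\widehat{c}$. *)

(* Defs.v *)
From mathcomp Require Import all_boot all_order all_algebra.
From mathcomp Require Import boolp reals.

Set Implicit Arguments.
Unset Strict Implicit.
Unset Printing Implicit Defensive.

Import Order.TTheory GRing.Theory Num.Theory.
Local Open Scope ring_scope.

(* A binary floating point arithmetic: precision in bits, least and greatest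
   exponent of a normalized number 1.b_1 b_2 ... * 2 ^ e, rounding function.
   Double precision has fp_prec = 53, fp_emin = -1022, fp_emax = 1023. *)
Record fp_arith (R : realType) := FpArith {
  fp_prec : nat;
  fp_emin : int;
  fp_emax : int;
  fp_rnd : R -> R }.

(* 0 and the normalized numbers with [prec] significant bits whose exponent
   satisfies [E]; [m] is the signed integral significand. *)
Definition float_set (R : realType) (prec : nat) (E : pred int) (f : R) : Prop :=
  f = 0 \/
  exists m e : int,
    [/\ (2 ^ prec.-1 <= `|m| < 2 ^ prec)%N, E e
      & f = m%:~R * 2 ^ (e - prec%:Z + 1)].

Definition is_float (R : realType) (A : fp_arith R) (f : R) : Prop :=
  float_set (fp_prec A) [pred e | fp_emin A <= e <= fp_emax A] f.

(* As in IEEE-754, rounding is specified with an unbounded exponent range, and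
   the exceptions are detected on the rounded value (see [fp_result]).
   The rule for breaking ties is left arbitrary. *)
Definition rounds_to_nearest (R : realType) (A : fp_arith R) : Prop :=
  forall r : R,
    float_set (fp_prec A) predT (fp_rnd A r) /\
    forall g : R, float_set (fp_prec A) predT g ->
      `|fp_rnd A r - r| <= `|g - r|.

Definition unit_roundoff (R : realType) (A : fp_arith R) : R :=
  2 ^- fp_prec A.

Definition gamma (R : realType) (A : fp_arith R) (k : nat) : R :=
  k%:R * unit_roundoff A / (1 - k%:R * unit_roundoff A).

(* The results of computations live in [option R]: [None] means that some
   operation overflowed or underflowed, i.e. that its rounded result is neither
   0 nor in the range of the normalized numbers. *)
Definition fp_result (R : realType) (A : fp_arith R) (r : R) : option R :=
  if `[< is_float A (fp_rnd A r) >] then Some (fp_rnd A r) else None.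

Definition fp_add (R : realType) (A : fp_arith R) (a b : R) := fp_result A (a + b).
Definition fp_sub (R : realType) (A : fp_arith R) (a b : R) := fp_result A (a - b).
Definition fp_mul (R : realType) (A : fp_arith R) (a b : R) := fp_result A (a * b).

Notation "'let?' x := e 'in' f" := (obind (fun x => f) e)
  (at level 200, x pattern, e at level 100, f at level 200).

Definition two_sum (R : realType) (A : fp_arith R) (a b : R) : option (R * R) :=
  let? x := fp_add A a b in
  let? z := fp_sub A x a in
  let? w := fp_sub A x z in
  let? u := fp_sub A a w in
  let? v := fp_sub A b z in
  let? y := fp_add A u v in
  Some (x, y).

(* The splitting exponent is half the precision, rounded up (27 for 53). *)
Definition veltkamp_split (R : realType) (A : fp_arith R) (a : R) : option (R * R) :=
  let? z := fp_mul A a (2 ^+ uphalf (fp_prec A) + 1) in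
  let? w := fp_sub A z a in
  let? x := fp_sub A z w in
  let? y := fp_sub A a x in
  Some (x, y).

Definition two_prod (R : realType) (A : fp_arith R) (a b : R) : option (R * R) :=
  let? x := fp_mul A a b in
  let? (ah, al) := veltkamp_split A a in
  let? (bh, bl) := veltkamp_split A b in
  let? hh := fp_mul A ah bh in
  let? lh := fp_mul A al bh in
  let? hl := fp_mul A ah bl in
  let? ll := fp_mul A al bl in
  let? e1 := fp_sub A x hh in
  let? e2 := fp_sub A e1 lh in
  let? e3 := fp_sub A e2 hl in
  let? y := fp_sub A ll e3 in
  Some (x, y).

(* Polynomials are given to the algorithms as sequences of coefficients, the
   constant coefficient first; trailing zero coefficients are allowed. *)
Fixpoint horner_fl (R : realType) (A : fp_arith R) (s : seq R) (x : R)
    : option R :=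
  match s with
  | [::] => Some 0
  | [:: a] => Some a
  | a :: s' =>
      let? r := horner_fl A s' x in
      let? q := fp_mul A r x in
      fp_add A q a
  end.

(* The result (s_0, p_pi, p_sigma) of the error free transformation. *)
Fixpoint eft_horner (R : realType) (A : fp_arith R) (s : seq R) (x : R)
    : option (R * seq R * seq R) :=
  match s with
  | [::] => Some (0, [::], [::])
  | [:: a] => Some (a, [::], [::])
  | a :: s' =>
      let? (r, ppi, psigma) := eft_horner A s' x in
      let? (q, pi_i) := two_prod A r x in
      let? (r', sigma_i) := two_sum A q a in
      Some (r', pi_i :: ppi, sigma_i :: psigma)
  end.

Fixpoint add_coefs (R : realType) (A : fp_arith R) (s1 s2 : seq R)
    : option (seq R) :=
  match s1, s2 with
  | a1 :: s1', a2 :: s2' =>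
      let? a := fp_add A a1 a2 in
      let? s := add_coefs A s1' s2' in
      Some (a :: s)
  | _, _ => Some [::]
  end.

Definition comp_horner (R : realType) (A : fp_arith R) (s : seq R) (x : R)
    : option R :=
  let? (r, ppi, psigma) := eft_horner A s x in
  let? q := add_coefs A ppi psigma in
  let? c := horner_fl A q x in
  fp_add A r c.

(* Meaningful when p.[x] != 0. *)
Definition cond (R : realType) (p : {poly R}) (x : R) : R :=
  (\sum_(i < size p) `|p`_i| * `|x| ^+ i) / `|p.[x]|.

Definition is_pred (R : realType) (A : fp_arith R) (r g : R) : Prop :=
  [/\ is_float A g, g < r & forall f : R, is_float A f -> f < r -> f <= g].

Definition is_succ (R : realType) (A : fp_arith R) (r g : R) : Prop :=
  [/\ is_float A g, r < g & forall f : R, is_float A f -> r < f -> g <= f].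

(* pred (f) < r < succ (f), where the least floating point number has
   predecessor -oo and the greatest one has successor +oo. *)
Definition faithful_rounding (R : realType) (A : fp_arith R) (f r : R) : Prop :=
  [/\ is_float A f,
      forall g : R, is_pred A f g -> g < r
    & forall g : R, is_succ A f g -> r < g].

(* Main.v *)
Require Import Defs.
From mathcomp Require Import all_boot all_order all_algebra.
From mathcomp Require Import boolp reals.
From mathcomp Require Import zify ring lra.

Set Implicit Arguments.
Unset Strict Implicit.
Unset Printing Implicit Defensive.

Import Order.TTheory GRing.Theory Num.Theory.
Local Open Scope ring_scope.

(** The first pass of the algorithm is an error free transformation: if r is
    the computed Horner value and c the exact value at x of the polynomial
    whose coefficients are the sums of the local errors, then p(x) = r + c
    exactly ([eft_horner_correct]). This holds because the error of each sum
    and of each product is itself a floating point number and is computed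
    exactly by the algorithms of Knuth and Dekker ([two_sum_correct],
    [two_prod_correct]).

    Let S be the value at |x| of the polynomial with coefficients |a_i|, and E
    that of the polynomial with coefficients |pi_i| + |sigma_i|. Each
    operation has relative error at most v = u / (1 - u). With
    K = (1 + v)^(2n) this gives E <= (K - 1) S, and the second Horner pass
    computes c up to an error (K - 1) E ([horner_add_coefs_correct]). Since
    1 + v is the inverse of 1 - u, Bernoulli's inequality bounds K - 1 by
    gamma_2n ([one_add_pow_le_gamma]), so that the exact sum of the two
    computed values is within gamma_2n^2 S = gamma_2n^2 cond(p, x) |p(x)| of
    p(x).

    Under the hypothesis on the condition number this distance is less than
    u/2 times the magnitude of the final result f ([relative_error_transfer]).
    Distinct floating point numbers f and g satisfy |f - g| >= u |f|
    ([float_gap]), so the distance is less than half the gap between f and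
    either of its neighbours, whereas rounding to nearest has moved the sum by
    no more than half of that gap: p(x) stays strictly between the neighbours
    ([faithful_of_small_error]).

    Exactness of sums and products is obtained by counting: a multiple of 2^q
    of magnitude at most 2^(prec + q) is a floating point number
    ([grid_float]), so an operation is exact as soon as its result lies on a
    grid that is coarse with respect to its size. These arguments take place
    in an unbounded exponent range. Dekker's product is exact for at least 4
    bits, and this much precision is available: a condition number is at least
    1, so the hypothesis forces u < 1/8 ([unit_roundoff_small]). *)

(** * Multiples of powers of two *)

Section Grid.
Variable R : realType.
Implicit Types (f g r : R) (q : int).

Definition on_grid q f : Prop := exists m : int, f = m%:~R * 2 ^ q.

Lemma pow2_gt0 q : 0 < 2 ^ q :> R.
Proof. by rewrite exprz_gt0. Qed.

Lemma pow2D q q' : 2 ^ (q + q') = 2 ^ q * 2 ^ q' :> R.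
Proof. by rewrite expfzDr ?pnatr_eq0. Qed.

Lemma pow2_le q q' : q <= q' -> 2 ^ q <= 2 ^ q' :> R.
Proof. by move=> h; rewrite ler_eXz2l // ltr1n. Qed.

(** Different steps differ by a factor of two at least; strict inequalities
    between exponents are used below in this form. *)
Lemma pow2_lt q q' : q < q' -> 2 * 2 ^ q <= 2 ^ q' :> R.
Proof.
move=> h; rewrite -{1}(expr1z (2 : R)) -pow2D pow2_le //; lia.
Qed.

Lemma on_gridB q f g : on_grid q f -> on_grid q g -> on_grid q (f - g).
Proof.
by move=> [m ->] [m' ->]; exists (m - m'); rewrite rmorphB /= mulrBl.
Qed.

Lemma on_gridD q f g : on_grid q f -> on_grid q g -> on_grid q (f + g).
Proof.
by move=> [m ->] [m' ->]; exists (m + m'); rewrite rmorphD /= mulrDl.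
Qed.

Lemma on_gridW q q' f : q' <= q -> on_grid q f -> on_grid q' f.
Proof.
move=> hq [m ->]; exists (m * 2 ^+ absz (q - q')).
rewrite rmorphM rmorphXn /= -mulrA exprnP -pow2D.
by congr (_ * 2 ^ _); lia.
Qed.

Lemma on_gridM q q' f g :
  on_grid q f -> on_grid q' g -> on_grid (q + q') (f * g).
Proof.
move=> [m ->] [m' ->]; exists (m * m').
by rewrite rmorphM /= pow2D; ring.
Qed.

Lemma on_grid_eq0 q f : on_grid q f -> `|f| < 2 ^ q -> f = 0.
Proof.
move=> [m ->]; rewrite normrM (gtr0_norm (pow2_gt0 q)) -intr_norm.
rewrite gtr_pMl ?pow2_gt0 // ltrz1 => h.
have -> : m = 0 by lia.
by rewrite mul0r.
Qed.

Lemma on_grid_ge q f : on_grid q f -> 0 < f -> 2 ^ q <= f.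
Proof.
move=> gf f0; rewrite leNgt; apply/negP => h.
have := on_grid_eq0 gf; rewrite gtr0_norm // => /(_ h) f00.
by rewrite f00 ltxx in f0.
Qed.

Lemma on_gridN q f : on_grid q f -> on_grid q (- f).
Proof. by move=> [m ->]; exists (- m); rewrite rmorphN mulNr. Qed.

End Grid.

(** * Floating point numbers and rounding to nearest *)

Section Float.
Variables (R : realType) (prec : nat).
Implicit Types (a b f g r : R) (q : int).
Local Notation float := (@float_set R prec predT).

(** The bound includes the next power of two, so that the arguments below need
    no separate treatment of a rounding up to it. *)
Lemma grid_float q f :
  (0 < prec)%N -> on_grid q f -> `|f| <= 2 ^+ prec * 2 ^ q -> float f.
Proof.
move=> prec0 [m ->].
rewrite normrM (gtr0_norm (pow2_gt0 R q)) ler_pM2r ?pow2_gt0 // -intr_norm.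
rewrite -natr_absz -natrX ler_nat => hm.
have [->|m0] := eqVneq m 0; first by rewrite mul0r; left.
right; move: hm; rewrite leq_eqVlt => /orP[/eqP hm|hm].
  (* The bound itself is the next power of two: the significand is halved. *)
  exists ((-1) ^+ (m < 0)%R * 2 ^+ prec.-1), (q + prec%:Z); split => //.
    by rewrite abszMsign abszX /= leqnn ltn_exp2l //; lia.
  have -> : q + prec%:Z - prec%:Z + 1 = 1 + q by ring.
  rewrite [in LHS](intEsign m) hm -[in LHS](prednK prec0) pow2D expr1z.
  by rewrite !rmorphM /= -pmulrn natrX exprS !rmorphXn /=; ring.
have m_gt0 : (0 < `|m|)%N by rewrite absz_gt0.
have := trunc_log_bounds (isT : 1 < 2)%N m_gt0.
set k := trunc_log 2 `|m| => /andP[k1 k2].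
have kp : (k < prec)%N.
  by rewrite -(@ltn_exp2l 2) //; apply: leq_ltn_trans k1 hm.
exists (m * 2 ^+ (prec.-1 - k)), (q + k%:Z); split => //.
  rewrite abszM abszX /=; apply/andP; split.
    rewrite -{1}(subnKC (_ : k <= prec.-1)%N); last by lia.
    by rewrite expnD leq_mul2r k1 orbT.
  have -> : (2 ^ prec = 2 ^ k.+1 * 2 ^ (prec.-1 - k))%N.
    by rewrite -expnD; congr (2 ^ _)%N; lia.
  by rewrite ltn_pmul2r ?expn_gt0.
rewrite rmorphM rmorphXn /= -mulrA exprnP -pow2D.
by congr (_ * 2 ^ _); lia.
Qed.

(** A factor 2 replaces the exponent prec - 1, so that only the two atoms
    2 ^ prec and 2 ^ q occur in linear arithmetic. The upper bound is sharp:
    [add_part_float] and [float_gap] use the whole step that it leaves below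
    the next power of two. *)
Lemma float_grid f : float f -> f != 0 -> exists q,
  [/\ on_grid q f, 2 ^+ prec * 2 ^ q <= 2 * `|f|
    & `|f| <= (2 ^+ prec - 1) * 2 ^ q].
Proof.
case=> [->|[m [e [hm _ ->]]] f0]; first by rewrite eqxx.
exists (e - prec%:Z + 1); set q := e - _ + _ in f0 *.
have [hm1 hm2] := andP hm.
rewrite normrM (gtr0_norm (pow2_gt0 R q)) -intr_norm -abszE.
have mE : (`|m|%N : int)%:~R = `|m|%:R :> R by [].
split; first by exists m.
  rewrite mulrA ler_pM2r ?pow2_gt0 // mE -natrX -natrM ler_nat.
  rewrite (leq_trans _ (_ : 2 * 2 ^ prec.-1 <= _)%N) ?leq_mul2l //.
  by rewrite -expnS leq_exp2l //; lia.
rewrite ler_pM2r ?pow2_gt0 // lerBrDr mE -natrX -(natrD _ _ 1) ler_nat.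
by rewrite addn1.
Qed.

Lemma pow2_float q : (0 < prec)%N -> float (2 ^ q : R).
Proof.
move=> p0; apply: (@grid_float q) => //; first by exists 1; rewrite mul1r.
rewrite (gtr0_norm (pow2_gt0 R q)) ler_pMl ?pow2_gt0 //.
by rewrite exprn_ege1 // ler1n.
Qed.

Lemma floatN f : float f -> float (- f).
Proof.
case=> [->|[m [e [hm he ->]]]]; first by rewrite oppr0; left.
by right; exists (- m), e; rewrite abszN; split=> //; rewrite rmorphN mulNr.
Qed.

Lemma float_scale k f : float f -> float (f * 2 ^ k).
Proof.
case=> [->|[m [e [hm he ->]]]]; first by rewrite mul0r; left.
right; exists m, (e + k); split=> //; rewrite -mulrA -pow2D.
by congr (_ * 2 ^ _); lia.
Qed.

Lemma float_norm f : float f -> float `|f|.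
Proof. by case: ger0P => // _; exact: floatN. Qed.

Lemma float_double f : float f -> float (2 * f).
Proof. by rewrite mulrC -[X in _ * X]expr1z; exact: float_scale. Qed.

(** A relation instead of the rounding function: whatever the tie-breaking rule,
    the relation is preserved by negation and by scaling with powers of two,
    which the function need not be. *)
Definition nearest r f : Prop :=
  float f /\ forall g, float g -> `|f - r| <= `|g - r|.

Lemma nearest_id r f : nearest r f -> float r -> f = r.
Proof.
move=> [_ /[apply]]; rewrite subrr normr0 normr_le0 subr_eq0.
by move/eqP.
Qed.

Lemma nearest0 f : nearest 0 f -> f = 0.
Proof. by move/nearest_id; apply; left. Qed.

Lemma nearest_ge r f g : nearest r f -> float g -> g <= r -> g <= f.
Proof.
move=> [_ hf] /hf h gr; rewrite leNgt; apply/negP => fg.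
by rewrite !ler0_norm in h; lra.
Qed.

Lemma nearestN r f : nearest r f -> nearest (- r) (- f).
Proof.
move=> [ff hf]; split; first by apply: floatN.
move=> g /floatN /hf.
have -> : - f - - r = - (f - r) by ring.
have -> : g - - r = - (- g - r) by ring.
by rewrite !normrN.
Qed.

Lemma nearest_le r f g : nearest r f -> float g -> r <= g -> f <= g.
Proof.
move=> /nearestN /nearest_ge hf /floatN /hf; rewrite !lerN2; exact.
Qed.

Lemma nearest_norm_ge r f g :
  nearest r f -> float g -> 0 <= g -> g <= `|r| -> g <= `|f|.
Proof.
move=> hf fg g0; have [r0|r0] := ger0P r => h.
  by rewrite (le_trans _ (ler_norm f)) ?(nearest_ge hf).
rewrite -normrN (le_trans _ (ler_norm _)) //.
by apply: (nearest_ge (nearestN hf)).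
Qed.

Lemma nearest_norm_le r f g :
  nearest r f -> float g -> `|r| <= g -> `|f| <= g.
Proof.
move=> hf fg; rewrite !ler_norml => /andP[h1 h2].
by rewrite (nearest_ge hf) ?(nearest_le hf) //; exact: floatN.
Qed.

Lemma nearest_scale k r f : nearest r f -> nearest (r * 2 ^ k) (f * 2 ^ k).
Proof.
move=> [ff hf]; split; first exact: float_scale.
move=> g fg; have /hf := float_scale (- k) fg.
have kk : 2 ^ (- k) * 2 ^ k = 1 :> R by rewrite -pow2D addNr expr0z.
rewrite -(ler_pM2r (pow2_gt0 R k)) -{1 2}(gtr0_norm (pow2_gt0 R k)).
by rewrite -!normrM !mulrBl -mulrA kk mulr1.
Qed.

(** Without a least exponent there are powers of two below any nonzero |r|. *)
Lemma nearest_eq0 r : (0 < prec)%N -> nearest r 0 -> r = 0.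
Proof.
move=> prec0 [_ h]; apply/eqP; apply: contraT => r0.
have n0 : 0 < `|r| by rewrite normr_gt0.
pose k := Num.bound `|r|^-1.
have /upper_nthrootP hk : (k <= k)%N by [].
have {}hk : 2 ^ (- k%:Z) < `|r|.
  by rewrite -exprnN invf_plt ?posrE ?exprn_gt0.
have k0 := pow2_gt0 R (- k%:Z).
have := pow2_float (- k%:Z) prec0; set g : R := 2 ^ _ in hk k0 * => fg.
have [rp|rn] := ger0P r.
  have := h _ fg; rewrite ger0_norm // in hk.
  rewrite sub0r normrN ger0_norm // ler0_norm; lra.
have := h _ (floatN fg); rewrite ltr0_norm // in hk.
rewrite sub0r normrN ltr0_norm // ger0_norm; lra.
Qed.

(** All multiples of 2 ^ q in this range are candidates for the rounding, and
    one of them is within half a step. *)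
Lemma nearest_err q r f : (0 < prec)%N ->
  nearest r f -> `|r| <= 2 ^+ prec * 2 ^ q -> `|f - r| <= 2 ^ q / 2.
Proof.
move=> prec0 [_ h] hr; have q0 := pow2_gt0 R q.
pose t := r / 2 ^ q; have rE : r = t * 2 ^ q by rewrite /t divfK ?gt_eqF.
pose k := Num.floor (t + 1 / 2).
have /andP[k1 k2] := floor_itv (t + 1 / 2); rewrite -/k rmorphD /= in k1 k2.
have ht : `|t| <= 2 ^+ prec.
  by rewrite rE normrM (gtr0_norm q0) ler_pM2r // in hr.
have [ht1 ht2] : - 2 ^+ prec <= t /\ t <= 2 ^+ prec.
  by move: ht; rewrite ler_norml => /andP.
have fk : float (k%:~R * 2 ^ q).
  apply: (@grid_float q) => //; first by exists k.
  rewrite normrM (gtr0_norm q0) ler_pM2r //.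
  have pE : 2 ^+ prec = (2 ^+ prec)%:~R :> R by rewrite rmorphXn.
  rewrite pE -intr_norm ler_int ler_norml.
  have : (- (2 ^+ prec : int) - 1)%:~R < k%:~R :> R.
    by rewrite rmorphB rmorphN /= -pE; lra.
  have : k%:~R < ((2 ^+ prec : int) + 1)%:~R :> R.
    by rewrite rmorphD /= -pE; lra.
  by rewrite !ltr_int; lia.
apply: le_trans (h _ fk) _; rewrite rE -mulrBl normrM (gtr0_norm q0) mulrC.
rewrite ler_pM2l // ler_norml; apply/andP; split; lra.
Qed.

(** Rounding is monotone, so f is at least as large as the power of two
    2 ^ (prec + q - 1), above which all floats are multiples of 2 ^ q. *)
Lemma nearest_grid_large q r f : (0 < prec)%N ->
  nearest r f -> 2 ^+ prec * 2 ^ q <= 2 * `|r| -> on_grid q f.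
Proof.
move=> prec0 hf hr.
have fe : float (2 ^ (prec%:Z + q - 1) : R) by exact: pow2_float.
have eE : 2 ^+ prec * 2 ^ q = 2 * 2 ^ (prec%:Z + q - 1) :> R.
  rewrite exprnP -pow2D -{2}(expr1z (2 : R)) -pow2D; congr (2 ^ _); lia.
have hf2 : 2 ^+ prec * 2 ^ q <= 2 * `|f|.
  rewrite eE ler_pM2l // in hr; rewrite eE ler_pM2l //.
  apply: (nearest_norm_ge hf) => //.
  by rewrite ltW ?pow2_gt0.
have q0 := pow2_gt0 R q.
have pp : 0 < 2 ^+ prec :> R by rewrite exprn_gt0.
have f0 : f != 0.
  by apply: contraTneq hf2 => ->; rewrite normr0 mulr0 -ltNge mulr_gt0.
have [q' [gf _ hq']] := float_grid hf.1 f0.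
apply: on_gridW gf; rewrite leNgt; apply/negP => /(pow2_lt R) hq.
have q'0 := pow2_gt0 R q'.
by nra.
Qed.

(** A multiple of 2 ^ q either is small enough to be a float, or is so large
    that floats of this size are multiples of 2 ^ q. *)
Lemma nearest_grid q r f : (0 < prec)%N ->
  nearest r f -> on_grid q r -> on_grid q f.
Proof.
move=> prec0 hf gr; have [h|h] := leP `|r| (2 ^+ prec * 2 ^ q).
  by rewrite (nearest_id hf) //; apply: grid_float gr h.
apply: (nearest_grid_large prec0 hf).
by have := normr_ge0 r; lra.
Qed.

Lemma nearest_half_ulp q r f : (0 < prec)%N -> nearest r f ->
  `|f| <= (2 ^+ prec - 1) * 2 ^ q -> `|f - r| <= 2 ^ q / 2.
Proof.
move=> prec0 hf h; apply: (nearest_err prec0 hf).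
have q0 := pow2_gt0 R q.
have pp : 0 < 2 ^+ prec :> R by rewrite exprn_gt0.
rewrite leNgt; apply/negP => /ltW hr.
have fp : float (2 ^+ prec * 2 ^ q).
  by rewrite exprnP -pow2D; apply: pow2_float.
by have := nearest_norm_ge hf fp _ hr; nra.
Qed.

(** The error is measured against the rounded value, whose exponent is at hand;
    [nearest_rel_err_exact] deduces a bound in terms of r. *)
Lemma nearest_rel_err r f : (0 < prec)%N ->
  nearest r f -> `|f - r| <= 2 ^- prec * `|f|.
Proof.
move=> prec0 hf; have [f0|f0] := eqVneq f 0.
  move: hf; rewrite f0 => /(nearest_eq0 prec0) ->.
  by rewrite subrr normr0 mulr0.
have [q [_ h1 h2]] := float_grid hf.1 f0.
have pp : 0 < 2 ^+ prec :> R by rewrite exprn_gt0.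
apply: le_trans (nearest_half_ulp prec0 hf h2) _.
by rewrite ler_pdivlMl //; lra.
Qed.

(** The extreme case is that f is a power of two and g its predecessor, at
    distance exactly 2 ^- prec * |f|. *)
Lemma float_gap f g : f != g -> float f -> float g ->
  2 ^- prec * `|f| <= `|f - g|.
Proof.
have pp : 0 < 2 ^+ prec :> R by rewrite exprn_gt0.
move=> fg ff fl_g; have [->|f0] := eqVneq f 0; first by rewrite normr0 mulr0.
have [q [gf h1 h2]] := float_grid ff f0.
have q0 := pow2_gt0 R q.
rewrite ler_pdivrMl //.
have same_grid : on_grid q g -> 2 ^+ prec * 2 ^ q <= 2 ^+ prec * `|f - g|.
  move=> gg; rewrite ler_pM2l // leNgt; apply/negP => /on_grid_eq0 h.
  have := h (on_gridB gf gg); move/eqP; rewrite subr_eq0; exact/negP.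
have [g0|g0] := eqVneq g 0.
  apply: (le_trans _ (same_grid _)); first by nra.
  by rewrite g0; exists 0; rewrite mul0r.
have [q' [gg h3 h4]] := float_grid fl_g g0.
have [qq'|/(pow2_lt R) qq'] := leP q q'.
  apply: le_trans (same_grid (on_gridW qq' gg)); nra.
have := lerB_dist f g; have q'0 := pow2_gt0 R q'.
have p1 : 1 <= 2 ^+ prec :> R by rewrite exprn_ege1 // ler1n.
have : 2 ^+ prec * ((2 ^+ prec - 1) * 2 ^ q') <= (2 ^+ prec - 1) * `|f|.
  rewrite mulrCA ler_wpM2l ?subr_ge0 //; nra.
have : 2 ^+ prec * `|g| <= 2 ^+ prec * ((2 ^+ prec - 1) * 2 ^ q').
  by rewrite ler_pM2l.
by nra.
Qed.

End Float.

(** * Exact errors of sums *)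

Section Sum.
Variables (R : realType) (prec : nat).
Implicit Types (a b f g r x : R) (q : int).
Local Notation float := (@float_set R prec predT).
Local Notation nearest := (@nearest R prec).

(** Sterbenz: the difference is on the finer of the two grids and is no larger
    than the smaller operand. *)
Lemma sterbenz a b : (0 < prec)%N ->
  float a -> float b -> b / 2 <= a -> a <= 2 * b -> float (a - b).
Proof.
move=> prec0 fa fb h1 h2.
have [a0|a0] := eqVneq a 0; first by rewrite a0 sub0r; exact: floatN.
have [b0|b0] := eqVneq b 0; first by rewrite b0 subr0.
have [q [ga _ ha]] := float_grid fa a0.
have [q' [gb _ hb]] := float_grid fb b0.
have [q0 q'0] := (pow2_gt0 R q, pow2_gt0 R q').
have [a_ge0 b_ge0] : 0 <= a /\ 0 <= b by split; lra.
rewrite !ger0_norm // in ha hb.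
have [qq'|/ltW qq'] := leP q q'.
  apply: (grid_float prec0 (on_gridB ga (on_gridW qq' gb))).
  rewrite ler_norml; apply/andP; split; lra.
apply: (grid_float prec0 (on_gridB (on_gridW qq' ga) gb)).
rewrite ler_norml; apply/andP; split; lra.
Qed.

(** The error lies on the finer of the grids of a and b, and it is no larger
    than the operand on that grid, as it is no larger than either operand. *)
Lemma add_error_float a b x : (0 < prec)%N ->
  float a -> float b -> nearest (a + b) x -> float (a + b - x).
Proof.
move=> prec0 fa fb hx.
have [a0|a0] := eqVneq a 0.
  by rewrite a0 add0r in hx *; rewrite (nearest_id hx) // subrr; left.
have [b0|b0] := eqVneq b 0.
  by rewrite b0 addr0 in hx *; rewrite (nearest_id hx) // subrr; left.
have [q [ga _ ha]] := float_grid fa a0.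
have [q' [gb _ hb]] := float_grid fb b0.
have [q0 q'0] := (pow2_gt0 R q, pow2_gt0 R q').
(* Each operand is itself a candidate for the rounding of the sum. *)
have ea : `|a + b - x| <= `|b|.
  rewrite distrC; apply: le_trans (hx.2 _ fa) _.
  by rewrite opprD addrA subrr add0r normrN.
have eb : `|a + b - x| <= `|a|.
  rewrite distrC; apply: le_trans (hx.2 _ fb) _.
  by rewrite opprD addrCA subrr addr0 normrN.
have [qq'|/ltW qq'] := leP q q'.
  have gs := on_gridD ga (on_gridW qq' gb).
  apply: (grid_float prec0 (on_gridB gs (nearest_grid prec0 hx gs))); lra.
have gs := on_gridD (on_gridW qq' ga) gb.
apply: (grid_float prec0 (on_gridB gs (nearest_grid prec0 hx gs))); lra.
Qed.

(** The exactness of the first subtraction in Dekker's fast two-sum: x - a is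
    a multiple of the finer of the steps of x and a, and it differs from the
    smaller operand b by at most half a step of x. If the step of x does not
    exceed that of b, the sum itself is exact. *)
Lemma add_part_float a b x : (0 < prec)%N -> float a -> float b ->
  `|b| <= `|a| -> nearest (a + b) x -> float (x - a).
Proof.
move=> prec0 fa fb ba hx.
have [b0|b0] := eqVneq b 0.
  by move: hx; rewrite b0 addr0 => /nearest_id -> //; rewrite subrr; left.
have a0 : a != 0 by rewrite -normr_gt0 (lt_le_trans _ ba) ?normr_gt0.
have [x0|x0] := eqVneq x 0; first by rewrite x0 sub0r; exact: floatN.
have [qa [ga la ha]] := float_grid fa a0.
have [qb [gb lb hb]] := float_grid fb b0.
have [qx [gx lx hxx]] := float_grid hx.1 x0.
have [qa0 [qb0 qx0]] := (pow2_gt0 R qa, (pow2_gt0 R qb, pow2_gt0 R qx)).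
have pp : 0 < 2 ^+ prec :> R by rewrite exprn_gt0.
have qab : qb <= qa by rewrite leNgt; apply/negP => /(pow2_lt R) h; nra.
have err := nearest_half_ulp prec0 hx hxx.
have tri : `|x - a| <= `|b| + 2 ^ qx / 2.
  have -> : x - a = b + (x - (a + b)) by ring.
  by apply: le_trans (ler_normD _ _) _; rewrite lerD2l.
have [qxb|/[dup] qbx /(pow2_lt R) qbx2] := leP qx qb.
  (* The sum lies on the grid of its rounding, hence is exact. *)
  have gs := on_gridD (on_gridW (le_trans qxb qab) ga) (on_gridW qxb gb).
  have /eqP : x - (a + b) = 0 by apply: (on_grid_eq0 (on_gridB gx gs)); lra.
  rewrite subr_eq0 => /eqP ->; by rewrite addrC addKr.
have [qxa|/[dup] qax /(pow2_lt R) qax2] := leP qx qa.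
  apply: (grid_float prec0 (on_gridB gx (on_gridW qxa ga))).
  have : 1 <= 2 ^+ prec :> R by rewrite exprn_ege1 // ler1n.
  nra.
apply: (grid_float prec0 (on_gridB (on_gridW (ltW qax) gx) ga)).
have qxa : 2 ^ qx <= 2 * 2 ^ qa :> R.
  have -> : 2 * 2 ^ qa = 2 ^ (1 + qa) :> R by rewrite pow2D expr1z.
  apply: pow2_le; rewrite leNgt; apply/negP => /(pow2_lt R).
  rewrite pow2D expr1z.
  have : `|x| <= 2 * `|a|.
    apply: (nearest_norm_le hx); first exact/float_double/float_norm.
    by have := ler_normD a b; lra.
  nra.
lra.
Qed.

(** The larger operand b agrees with x - a up to the rounding error of the sum,
    which is at most |b| / 2, so that z stays within a factor two of b and
    [sterbenz] applies. *)
Lemma add_rest_float a b x z : (1 < prec)%N -> float a -> float b ->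
  `|a| <= `|b| -> nearest (a + b) x -> nearest (x - a) z -> float (b - z).
Proof.
move=> prec1 fa fb ab hx hz.
have prec0 := ltnW prec1.
wlog b0 : a b x z fa fb ab hx hz / 0 <= b.
  move=> IH; have [b0|b0] := leP 0 b; first exact: IH fa fb ab hx hz b0.
  have -> : b - z = - (- b - - z) by ring.
  apply: floatN; apply: (IH (- a) (- b) (- x)); rewrite ?normrN //.
  - exact: floatN.
  - exact: floatN.
  - by rewrite -opprD; exact: nearestN.
  - by rewrite -opprD; exact: nearestN.
  - by rewrite oppr_ge0 ltW.
rewrite (ger0_norm b0) in ab.
have [ab1 ab2] : - b <= a /\ a <= b by move: ab; rewrite ler_norml => /andP.
have u4 : 2 ^- prec <= 1 / 4 :> R.
  rewrite -[1 / 4]invf_div divr1 lef_pV2 ?posrE ?exprn_gt0 //.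
  by rewrite (_ : 4 = 2 ^+ 2) ?ler_eXn2l ?ltr1n //; ring.
have u0 : 0 < 2 ^- prec :> R by rewrite invr_gt0 exprn_gt0.
have hx2 : `|x| <= 2 * b.
  apply: (nearest_norm_le hx); first exact: float_double.
  by rewrite ler_norml; apply/andP; split; lra.
have : `|x - (a + b)| <= b / 2.
  apply: le_trans (nearest_rel_err prec0 hx) _.
  have := normr_ge0 x; nra.
rewrite ler_norml => /andP[d1 d2].
have fb2 : float (b / 2).
  by have := float_scale (-1) fb; rewrite exprN1.
apply: sterbenz => //; first exact: hz.1.
- suff : z <= 2 * b by lra.
  by apply: (nearest_le hz); [exact: float_double | lra].
- suff : b / 2 <= z by lra.
  by apply: (nearest_ge hz) => //; lra.
Qed.

(** A sum smaller than both of its operands comes from a cancellation in which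
    they have opposite signs and agree up to a factor two. *)
Lemma add_cancel_float a b x : (0 < prec)%N -> float a -> float b ->
  `|a| <= `|b| -> nearest (a + b) x -> `|x| < `|a| -> float (a + b).
Proof.
move=> prec0 fa fb ab hx xa.
wlog b0 : a b x fa fb ab hx xa / 0 <= b.
  move=> IH; have [b0|b0] := leP 0 b; first exact: IH fa fb ab hx xa b0.
  have -> : a + b = - (- a - b) by ring.
  apply: floatN; apply: (IH (- a) (- b) (- x)); rewrite ?normrN //.
  - exact: floatN.
  - exact: floatN.
  - by rewrite -opprD; exact: nearestN.
  - by rewrite oppr_ge0 ltW.
have -> : a + b = b - (- a) by ring.
have fNa := floatN fa.
rewrite (ger0_norm b0) in ab.
have a0 : a < 0.
  rewrite ltNge; apply/negP => a0.
  have : a <= x by apply: (nearest_ge hx) => //; lra.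
  by rewrite leNgt -(ger0_norm a0) (le_lt_trans (ler_norm x) xa).
rewrite (ltr0_norm a0) in ab xa.
have b2 : b < 2 * (- a).
  rewrite ltNge; apply/negP => b2.
  have : - a <= x by apply: (nearest_ge hx) => //; lra.
  by rewrite leNgt (le_lt_trans (ler_norm x) xa).
by apply: sterbenz => //; lra.
Qed.

(** Knuth's argument. If |b| <= |a|, then z is exact, w recovers a, and v is the
    whole error. Otherwise v is exact, and either |a| <= |x|, so that the steps
    that produce z, w and u are a fast two-sum of x and -a, or the sum cancels
    and is exact. *)
Lemma two_sum_correct a b x z w u v y : (1 < prec)%N ->
  float a -> float b ->
  nearest (a + b) x -> nearest (x - a) z -> nearest (x - z) w ->
  nearest (a - w) u -> nearest (b - z) v -> nearest (u + v) y ->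
  a + b = x + y.
Proof.
move=> prec1 fa fb hx hz hw hu hv hy.
have prec0 := ltnW prec1.
have ferr := add_error_float prec0 fa fb hx.
have [ba|/ltW ab] := leP `|b| `|a|.
  have zE : z = x - a := nearest_id hz (add_part_float prec0 fa fb ba hx).
  have xz : x - z = a by rewrite zE; ring.
  have wE : w = a by rewrite xz in hw; exact: nearest_id hw fa.
  have uE : u = 0 by rewrite wE subrr in hu; exact: nearest0 hu.
  have bz : b - z = a + b - x by rewrite zE; ring.
  have vE : v = a + b - x by rewrite bz in hv; exact: nearest_id hv ferr.
  rewrite uE vE add0r in hy.
  by rewrite (nearest_id hy ferr); ring.
have vE : v = b - z := nearest_id hv (add_rest_float prec1 fa fb ab hx hz).
suff [wE uE] : w = x - z /\ u = a - w.
  have uv : u + v = a + b - x by rewrite uE vE wE; ring.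
  rewrite uv in hy.
  by rewrite (nearest_id hy ferr); ring.
have [ax|xa] := leP `|a| `|x|.
  have fNa := floatN fa.
  have fxz : float (x - z).
    rewrite -opprB; apply: floatN.
    by apply: (add_part_float prec0 hx.1 fNa _ hz); rewrite normrN.
  have wE := nearest_id hw fxz; split=> //.
  apply: (nearest_id hu); rewrite wE.
  have -> : a - (x - z) = - (x + - a - z) by ring.
  exact/floatN/(add_error_float prec0 hx.1 fNa hz).
(* Cancellation: a + b is then exact, and so is everything that follows. *)
have fab := add_cancel_float prec0 fa fb ab hx xa.
have xE := nearest_id hx fab.
have zE : z = b.
  by rewrite xE addrC addKr in hz; exact: nearest_id hz fb.
have wE : w = a.
  by rewrite xE zE addrK in hw; exact: nearest_id hw fa.
split; first by rewrite wE xE zE addrK.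
by rewrite wE subrr in hu; rewrite wE subrr; exact: nearest0 hu.
Qed.
End Sum.

(** * Exact errors of products *)

Section Product.
Variables (R : realType) (prec : nat).
Implicit Types (a b f g r x : R) (q : int).
Local Notation float := (@float_set R prec predT).
Local Notation nearest := (@nearest R prec).

(** The roundings performed by Veltkamp's splitting, with overflow and underflow
    forgotten. *)
Definition split_steps s a ah al : Prop :=
  exists z w, [/\ nearest (a * (2 ^+ s + 1)) z, nearest (z - a) w,
    nearest (z - w) ah & nearest (a - ah) al].

Lemma split_steps0 s ah al : split_steps s 0 ah al -> ah = 0 /\ al = 0.
Proof.
move=> [z [w []]]; rewrite mul0r => /nearest0 ->; rewrite subrr => /nearest0 ->.
by rewrite subrr => /nearest0 ->; rewrite subrr => /nearest0 ->.
Qed.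

Lemma split_steps_scale k s a ah al : split_steps s a ah al ->
  split_steps s (a * 2 ^ k) (ah * 2 ^ k) (al * 2 ^ k).
Proof.
move=> [z [w [hz hw hh hl]]]; exists (z * 2 ^ k), (w * 2 ^ k); split.
- by rewrite mulrAC; exact: nearest_scale.
- by rewrite -mulrBl; exact: nearest_scale.
- by rewrite -mulrBl; exact: nearest_scale.
- by rewrite -mulrBl; exact: nearest_scale.
Qed.

Lemma split_stepsN s a ah al :
  split_steps s a ah al -> split_steps s (- a) (- ah) (- al).
Proof.
move=> [z [w [hz hw hh hl]]]; exists (- z), (- w); split.
- by rewrite mulNr; exact: nearestN.
- by rewrite -opprD; exact: nearestN.
- by rewrite -opprD; exact: nearestN.
- by rewrite -opprD; exact: nearestN.
Qed.

(** Since w approximates z - a, the rounding error of z cancels in z - w, which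
    differs from a by the rounding error of w alone. Both z and w are multiples
    of 2 ^ s, and w is accurate to half of this step, so z - w is a multiple of
    2 ^ s nearest to a: the high part, which leaves at most half a step to the
    low part. *)
Lemma split_correct s a ah al : (s < prec)%N -> on_grid 0 a ->
  2 ^+ prec <= 2 * `|a| -> `|a| <= 2 ^+ prec - 1 -> split_steps s a ah al ->
  [/\ on_grid s ah, `|ah| <= 2 ^+ prec, on_grid 0 al, `|al| <= 2 ^+ s / 2
    & a = ah + al].
Proof.
move=> sp; have prec0 := leq_ltn_trans (leq0n s) sp.
wlog a0 : a ah al / 0 <= a.
  move=> IH; have [a0|a0] := leP 0 a; first exact: IH.
  move=> ga h1 h2 /split_stepsN hs.
  have [] := IH _ _ _ _ (on_gridN ga) _ _ hs; rewrite ?oppr_ge0 ?normrN //.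
    exact: ltW.
  move=> /on_gridN + ? /on_gridN; rewrite !opprK => ? ? ? ?.
  by split=> //; lra.
rewrite (ger0_norm a0) => ga la ha [z [w [hz hw hh hl]]].
set P : R := 2 ^+ prec in la ha *; set S : R := 2 ^+ s in hz *.
have sE : 2 ^ s%:Z = S by [].
have S0 : 0 < S by rewrite exprn_gt0.
have S1 : 1 <= S by rewrite exprn_ege1 // ler1n.
have P0 : 0 < P by rewrite exprn_gt0.
have PE : P = 2 * 2 ^ (prec.-1)%:Z.
  by rewrite /P -{1}(prednK prec0) exprS.
have SP : 2 * S <= P.
  by rewrite -exprS ler_eXn2l ?ltr1n.
have [X [gX X1 X2 zw]] : exists X, [/\ on_grid s X, X - a <= S / 2,
    a - X <= S / 2 & z - w = X].
  have tE : 2 ^ (prec.-1)%:Z = P / 2 by rewrite PE; field.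
  have ga2 : on_grid 0 (P / 2).
    apply: (@on_gridW _ (prec.-1)%:Z) => //; rewrite -tE.
    by exists 1; rewrite mul1r.
  (* For the least significand the error bound for z would not exclude that
     z - a falls below P * S / 2, where floats are finer than 2 ^ s; but then
     every step is exact. *)
  have [aE|an] := eqVneq a (P / 2).
    have gt : on_grid (prec.-1)%:Z a.
      by exists 1; rewrite mul1r tE.
    have gS : on_grid 0 S.
      by apply: (@on_gridW _ s%:Z) => //; exists 1; rewrite mul1r.
    have g1 : on_grid 0 (1 : R) by exists 1; rewrite expr0z mulr1.
    have big c : on_grid 0 c -> 0 <= c -> c <= P -> float (a * c).
      move=> gc c0 cP; have := on_gridM gt gc; rewrite addr0 => gac.
      apply: (grid_float prec0 gac).
      by rewrite tE -/P normrM !ger0_norm // aE mulrC ler_pM2r //; lra.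
    have P2 : 2 <= P by rewrite PE ler_peMr // -exprnP exprn_ege1 ?ler1n.
    have zE : z = a * (S + 1).
      by apply: (nearest_id hz); apply: big (on_gridD gS g1) _ _; lra.
    have wE : w = a * S.
      have zaE : z - a = a * S by rewrite zE; ring.
      rewrite zaE in hw; apply: (nearest_id hw); apply: big gS _ _; lra.
    exists a; split; [|lra|lra|by rewrite zE wE; ring].
    by apply: on_gridW gt; lia.
  have {}an : 1 <= a - P / 2.
    have := on_grid_ge (on_gridB ga ga2); rewrite expr0z; apply.
    by rewrite subr_gt0 lt_neqAle eq_sym an; lra.
  have gz : on_grid s z.
    apply: (nearest_grid_large prec0 hz); rewrite sE -/P ger0_norm; nra.
  have : `|z - a * (S + 1)| <= 2 ^ (s.+1)%:Z / 2.
    apply: (nearest_err prec0 hz); rewrite -exprnP exprS -/P -/S.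
    rewrite ger0_norm; nra.
  rewrite -exprnP exprS -/S ler_norml => /andP[ez1 ez2].
  have aS1 : (P / 2 + 1) * S <= a * S by rewrite ler_pM2r //; lra.
  have aS2 : a * S <= (P - 1) * S by rewrite ler_pM2r.
  have zaP : 0 <= z - a by nra.
  have gw : on_grid s w.
    by apply: (nearest_grid_large prec0 hw); rewrite sE -/P ger0_norm //; lra.
  have : `|w - (z - a)| <= S / 2.
    apply: (@nearest_err _ _ s _ _ prec0 hw).
    by rewrite sE -/P ger0_norm //; lra.
  rewrite ler_norml => /andP[ew1 ew2].
  by exists (z - w); split=> //; [exact: on_gridB | lra | lra].
rewrite zw in hh hl.
have fX : float X.
  apply: (grid_float prec0 gX); rewrite sE -/P ler_norml.
  by apply/andP; split; nra.
have ahE := nearest_id hh fX; rewrite ahE in hl *.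
have gX0 : on_grid 0 X by apply: on_gridW gX.
have gl := on_gridB ga gX0.
have nl : `|a - X| <= S / 2 by rewrite ler_norml; apply/andP; split; lra.
have fl : float (a - X).
  by apply: (grid_float prec0 gl); rewrite expr0z mulr1 -/P; lra.
rewrite (nearest_id hl fl); split=> //; last by ring.
rewrite ler_norml; apply/andP; split; first by lra.
have gP : on_grid s P.
  by apply: (@on_gridW _ prec); [lia | exists 1; rewrite mul1r].
rewrite leNgt; apply/negP => hX.
by have := on_grid_ge (on_gridB gX gP); rewrite subr_gt0 sE => /(_ hX); lra.
Qed.

(** The roundings of Dekker's product that follow the splittings and the
    computation of x. *)
Definition dekker_steps ah al bh bl x y : Prop :=
  exists hh lh hl ll e1 e2 e3, [/\ nearest (ah * bh) hh, nearest (al * bh) lh,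
    nearest (ah * bl) hl & nearest (al * bl) ll] /\
   [/\ nearest (x - hh) e1, nearest (e1 - lh) e2,
    nearest (e2 - hl) e3 & nearest (ll - e3) y].

(** These inequalities make Dekker's product exact, for s half the precision
    rounded up. The last one fails for 3 bits. *)
Lemma split_powers s :
  (s < prec)%N -> (prec <= 2 * s)%N -> (2 * s <= prec.+1)%N -> (3 < prec)%N ->
  [/\ 2 ^+ prec <= 2 ^+ s * 2 ^+ s :> R, 2 ^+ s * 2 ^+ s <= 2 * 2 ^+ prec :> R,
    4 <= 2 ^+ s :> R & 2 * (1 + 2 ^+ s) <= 2 ^+ prec :> R].
Proof.
move=> sp ps sp2 prec4.
have [h1 h2] : (prec <= s + s)%N /\ (s + s <= prec.+1)%N by lia.
have [h3 h4] : (2 <= s)%N /\ (2 + s <= prec)%N by lia.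
have S4 : 4 <= 2 ^+ s :> R.
  by rewrite (le_trans _ (_ : 2 ^+ 2 <= _)) ?ler_eXn2l ?ltr1n // expr2; lra.
have SP : 2 ^+ 2 * 2 ^+ s <= 2 ^+ prec :> R.
  by rewrite -exprD ler_eXn2l ?ltr1n.
split=> //; last by rewrite expr2 in SP; lra.
- by rewrite -exprD ler_eXn2l ?ltr1n.
- by rewrite -exprD -exprS ler_eXn2l ?ltr1n.
Qed.

(** With d the rounding error of x, the left-hand sides bound d + al bl,
    d + al bl + ah bl and d + al bl + ah bl + al bh, the successive partial sums
    read backwards; the right-hand sides are 2 ^ prec times the steps of their
    grids. *)
Lemma dekker_bounds (P S : R) :
  P <= S * S -> S * S <= 2 * P -> 4 <= S -> 2 * (1 + S) <= P ->
  [/\ P / 2 + S / 2 * (S / 2) <= P,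
    P / 2 + S / 2 * (S / 2) + P * (S / 2) <= P * S
    & P / 2 + S / 2 * (S / 2) + P * (S / 2) + S / 2 * P <= P * (P / 2)].
Proof.
move=> h1 h2 h3 h4; have P0 : 0 < P by lra.
have PS4 : P * 4 <= P * S by rewrite ler_pM2l.
have PPS : P * (2 * (1 + S)) <= P * P by rewrite ler_pM2l.
by split; lra.
Qed.

(** The four partial products are floats since the halves have about half of the
    bits. Each subtraction from x then removes one of them, which leaves a
    smaller number on a finer grid that still fits, until only the error
    a b - x remains.
    The operands are scaled to integers of exactly prec bits. *)
Lemma dekker_correct s a b ah al bh bl x y :
  (s < prec)%N -> (prec <= 2 * s)%N -> (2 * s <= prec.+1)%N -> (3 < prec)%N ->
  2 ^+ prec <= 2 * `|a| -> `|a| <= 2 ^+ prec - 1 ->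
  2 ^+ prec <= 2 * `|b| -> `|b| <= 2 ^+ prec - 1 ->
  on_grid s ah -> `|ah| <= 2 ^+ prec -> on_grid 0 al -> `|al| <= 2 ^+ s / 2 ->
  a = ah + al ->
  on_grid s bh -> `|bh| <= 2 ^+ prec -> on_grid 0 bl -> `|bl| <= 2 ^+ s / 2 ->
  b = bh + bl ->
  nearest (a * b) x -> dekker_steps ah al bh bl x y -> a * b = x + y.
Proof.
move=> sp ps sp2 prec4.
have [PS SP S4 S1P] := split_powers sp ps sp2 prec4.
have prec0 : (0 < prec)%N := leq_ltn_trans (leq0n s) sp.
have sp' : (s : int) <= prec.-1 by lia.
have ps' : (prec.-1 : int) <= (s : int) + s by lia.
have tE : 2 ^ (prec.-1)%:Z = 2 ^+ prec / 2 :> R.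
  by rewrite -{2}(prednK prec0) exprS -exprnP; field.
have sE : 2 ^ s%:Z = 2 ^+ s :> R by [].
have ssE : 2 ^ (s%:Z + s%:Z) = 2 ^+ s * 2 ^+ s :> R by rewrite pow2D.
have P0 : 0 < 2 ^+ prec :> R by rewrite exprn_gt0.
have S0 : 0 < 2 ^+ s :> R by rewrite exprn_gt0.
have PP : 2 ^+ prec = 2 ^ prec :> R by [].
move: (2 ^+ prec) (2 ^+ s) PS SP S4 S1P tE sE ssE P0 S0 PP
  => P S PS SP S4 S1P tE sE ssE P0 S0 PP.
have [b3 b2 b1] := dekker_bounds PS SP S4 S1P.
have [b4 b5] : S / 2 * P <= P * S /\ P * (S / 2) <= P * S.
  by have := mulr_gt0 P0 S0; split; lra.
have b6 : S / 2 * (S / 2) <= P by lra.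
move=> la ha lb hb gah nah gal nal aE gbh nbh gbl nbl bE hx.
move=> [hh [lh [hl [ll [e1 [e2 [e3 [[hhh hlh hhl hll] [he1 he2 he3 hy]]]]]]]]].
have bound (u v U V : R) : `|u| <= U -> `|v| <= V -> `|u * v| <= U * V.
  by move=> hu hv; rewrite normrM ler_pM.
have nhh := bound _ _ _ _ nah nbh; have nlh := bound _ _ _ _ nal nbh.
have nhl := bound _ _ _ _ nah nbl; have nll := bound _ _ _ _ nal nbl.
have ghh := on_gridM gah gbh; have glh := on_gridM gal gbh.
have ghl := on_gridM gah gbl; have gll := on_gridM gal gbl.
rewrite ?add0r ?addr0 in glh ghl gll.
have exact q f g :
    nearest f g -> on_grid q f -> `|f| <= P * 2 ^ q -> g = f.
  by move=> hg gf; rewrite PP => /(grid_float prec0 gf); exact: nearest_id.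
have hhE : hh = ah * bh.
  apply: (exact _ _ _ hhh ghh); rewrite ssE.
  by apply: le_trans nhh _; rewrite ler_pM2l.
have lhE : lh = al * bh.
  by apply: (exact _ _ _ hlh glh); rewrite sE (le_trans nlh).
have hlE : hl = ah * bl.
  by apply: (exact _ _ _ hhl ghl); rewrite sE (le_trans nhl).
have llE : ll = al * bl.
  by apply: (exact _ _ _ hll gll); rewrite expr0z mulr1 (le_trans nll).
have ha' : `|a| <= P by apply: le_trans ha _; rewrite gerBl.
have hb' : `|b| <= P by apply: le_trans hb _; rewrite gerBl.
have err : `|x - a * b| <= P / 2.
  rewrite PP; apply: (nearest_err prec0 hx); rewrite exprnP -PP.
  exact: bound.
have gx : on_grid prec.-1 x.
  apply: (nearest_grid_large prec0 hx); rewrite exprnP -PP tE normrM.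
  have : P * P <= (2 * `|a|) * (2 * `|b|) by rewrite ler_pM // ltW.
  by clear; lra.
set d := x - a * b in err.
have n3 := le_trans (ler_normD _ _) (lerD err nll).
have n2 := le_trans (ler_normD _ _) (lerD n3 nhl).
have n1 := le_trans (ler_normD _ _) (lerD n2 nlh).
have r1 : x - ah * bh = d + al * bl + ah * bl + al * bh.
  by rewrite /d aE bE; ring.
rewrite hhE in he1; rewrite lhE in he2; rewrite hlE in he3; rewrite llE in hy.
have g1 : on_grid prec.-1 (d + al * bl + ah * bl + al * bh).
  by rewrite -r1; apply: on_gridB gx (on_gridW _ ghh).
have e1E : e1 = d + al * bl + ah * bl + al * bh.
  by rewrite r1 in he1; apply: (exact _ _ _ he1 g1); rewrite tE (le_trans n1).
rewrite e1E addrK in he2.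
have g2 : on_grid s (d + al * bl + ah * bl).
  rewrite -[_ + _](addrK (al * bh)).
  by apply: on_gridB glh; apply: on_gridW g1.
have e2E : e2 = d + al * bl + ah * bl.
  by apply: (exact _ _ _ he2 g2); rewrite sE (le_trans n2).
rewrite e2E addrK in he3.
have g3 : on_grid 0 (d + al * bl).
  rewrite -[_ + _](addrK (ah * bl)).
  by apply: on_gridB; [apply: on_gridW g2 | apply: on_gridW ghl].
have e3E : e3 = d + al * bl.
  by apply: (exact _ _ _ he3 g3); rewrite expr0z mulr1 (le_trans n3).
have r4 : al * bl - (d + al * bl) = - d by ring.
rewrite e3E r4 in hy.
have -> : y = - d.
  apply: (exact 0 _ _ hy); last first.
    by rewrite expr0z mulr1 normrN (le_trans err) // ler_pdivrMr //; lra.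
  by rewrite -r4; exact: on_gridB.
by rewrite /d; ring.
Qed.

Lemma dekker_steps_scale k k' ah al bh bl x y :
  dekker_steps ah al bh bl x y ->
  dekker_steps (ah * 2 ^ k) (al * 2 ^ k) (bh * 2 ^ k') (bl * 2 ^ k')
    (x * 2 ^ (k + k')) (y * 2 ^ (k + k')).
Proof.
move=> [hh [lh [hl [ll [e1 [e2 [e3 [[h1 h2 h3 h4] [h5 h6 h7 h8]]]]]]]]].
pose t : R := 2 ^ (k + k').
have sc u v w : nearest (u * v) w -> nearest (u * 2 ^ k * (v * 2 ^ k')) (w * t).
  by rewrite mulrACA -pow2D; exact: nearest_scale.
have sd u v w : nearest (u - v) w -> nearest (u * t - v * t) (w * t).
  by rewrite -mulrBl; exact: nearest_scale.
exists (hh * t), (lh * t), (hl * t), (ll * t), (e1 * t), (e2 * t), (e3 * t).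
by split; split; auto.
Qed.

Lemma dekker_steps0 ah al bh bl y :
  ah = 0 /\ al = 0 \/ bh = 0 /\ bl = 0 ->
  dekker_steps ah al bh bl 0 y -> y = 0.
Proof.
move=> h0 [hh [lh [hl [ll [e1 [e2 [e3 [[]]]]]]]]].
have [[-> ->] [-> ->]] :
    (ah * bh = 0 /\ al * bh = 0) /\ (ah * bl = 0 /\ al * bl = 0).
  by case: h0 => -[-> ->]; rewrite !(mul0r, mulr0).
do 4!move=> /nearest0 ->; rewrite subrr => -[/nearest0 ->].
by rewrite subrr => /nearest0 ->; rewrite subrr => /nearest0 ->;
   rewrite subrr => /nearest0.
Qed.

Lemma float_normalize a : float a -> a != 0 -> exists k,
  [/\ on_grid 0 (a * 2 ^ k), 2 ^+ prec <= 2 * `|a * 2 ^ k|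
    & `|a * 2 ^ k| <= 2 ^+ prec - 1].
Proof.
move=> fa a0; have [q [ga la ha]] := float_grid fa a0.
have kk c : c = c * 2 ^ q * 2 ^ (- q) :> R.
  by rewrite -mulrA -pow2D subrr expr0z mulr1.
have q0 := pow2_gt0 R (- q); exists (- q); split.
- rewrite -(subrr q); apply: on_gridM ga _.
  by exists 1; rewrite mul1r.
- by rewrite normrM (gtr0_norm q0) mulrA [leLHS]kk ler_pM2r.
- by rewrite normrM (gtr0_norm q0) [leRHS]kk ler_pM2r.
Qed.

(** A zero operand has no significand of exactly prec bits, and all its partial
    products vanish; otherwise scaling reduces to [dekker_correct]. *)
Lemma two_prod_correct a b ah al bh bl x y (s := uphalf prec) :
  (3 < prec)%N -> float a -> float b ->
  split_steps s a ah al -> split_steps s b bh bl ->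
  nearest (a * b) x -> dekker_steps ah al bh bl x y -> a * b = x + y.
Proof.
move=> prec4 fa fb sa sb hx hd.
have sp : (s < prec)%N by rewrite /s; lia.
have sp1 : (prec <= 2 * s)%N by rewrite /s; lia.
have sp2 : (2 * s <= prec.+1)%N by rewrite /s; lia.
have [a0|a0] := eqVneq a 0.
  rewrite a0 in sa hx *; rewrite mul0r in hx *.
  rewrite (nearest0 hx) in hd *.
  by rewrite (dekker_steps0 (or_introl (split_steps0 sa)) hd) addr0.
have [b0|b0] := eqVneq b 0.
  rewrite b0 in sb hx *; rewrite mulr0 in hx *.
  rewrite (nearest0 hx) in hd *.
  by rewrite (dekker_steps0 (or_intror (split_steps0 sb)) hd) addr0.
have [k [ga la ha]] := float_normalize fa a0.
have [k' [gb lb hb]] := float_normalize fb b0.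
have [g1 n1 g2 n2 aE] := split_correct sp ga la ha (split_steps_scale k sa).
have [g3 n3 g4 n4 bE] := split_correct sp gb lb hb (split_steps_scale k' sb).
have := dekker_correct sp sp1 sp2 prec4 la ha lb hb g1 n1 g2 n2 aE g3 n3 g4 n4
  bE _ (dekker_steps_scale k k' hd).
rewrite mulrACA -pow2D -mulrDl => /(_ (nearest_scale _ hx)).
by apply: mulIf; rewrite gt_eqF ?pow2_gt0.
Qed.
End Product.

(** * Error propagation in the Horner scheme *)

Section Horner.
Variable R : realType.
Implicit Types (a b c d e q r x u v K S D : R) (s : seq R).

(** The numerator of the condition number. *)
Definition abs_horner s x : R := horner_rec [seq `|a| | a <- s] `|x|.

Lemma abs_horner_ge0 s x : 0 <= abs_horner s x.
Proof.
by elim: s => //= a s ih; rewrite addr_ge0 ?mulr_ge0.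
Qed.

Lemma abs_hornerE (p : {poly R}) x :
  abs_horner p x = \sum_(i < size p) `|p`_i| * `|x| ^+ i.
Proof.
rewrite /abs_horner; elim: (polyseq p) => [|a s ih] /=.
  by rewrite big_ord0.
rewrite big_ord_recl /= expr0 mulr1 addrC ih mulr_suml; congr (_ + _).
by apply: eq_bigr => i _; rewrite exprSr mulrA.
Qed.

Lemma horner_le_abs s x : `|horner_rec s x| <= abs_horner s x.
Proof.
elim: s => [|a s ih] /=; first by rewrite normr0.
apply: le_trans (ler_normD _ _) _; rewrite normrM /abs_horner /=.
by rewrite lerD2r ler_wpM2r.
Qed.

Lemma rel_err_norm v r f : `|f - r| <= v * `|r| -> `|f| <= (1 + v) * `|r|.
Proof. by move=> h; have := ler_normD (f - r) r; rewrite subrK; lra. Qed.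

(** One step of the transformation, for an accumulated value r and accumulated
    local errors of total size D. The induction closes because both bounds,
    K * S and (K - 1) * S, keep their form when (1 + v) ^ 2 is moved into K. *)
Lemma eft_horner_step v K r x a q r' S D :
  0 <= v -> 1 <= K -> `|r| <= K * S -> D <= (K - 1) * S ->
  `|q - r * x| <= v * `|r * x| -> `|r' - (q + a)| <= v * `|q + a| ->
  let w := (1 + v) ^+ 2 in
  `|r'| <= w * K * (S * `|x| + `|a|) /\
  D * `|x| + (`|q - r * x| + `|r' - (q + a)|)
    <= (w * K - 1) * (S * `|x| + `|a|).
Proof.
move=> v0 K1 hr hD hq hr' w.
have nq := rel_err_norm hq; have nr' := rel_err_norm hr'.
have qa := ler_normD q a.
have rx : `|r * x| <= K * (S * `|x|) by rewrite normrM mulrA ler_wpM2r.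
have S0 : 0 <= S by have := normr_ge0 r; nra.
have Sx0 : 0 <= S * `|x| by rewrite mulr_ge0.
have Dx : D * `|x| <= (K - 1) * (S * `|x|) by rewrite mulrA ler_wpM2r.
move: (`|r * x|) (S * `|x|) (D * `|x|) (normr_ge0 (r * x)) (normr_ge0 a)
  hq hr' nq nr' qa rx Sx0 Dx => y z t y0 a0 hq hr' nq nr' qa rx Sx0 Dx.
have wE : w = 1 + 2 * v + v * v by rewrite /w expr2; ring.
have v1 : (1 + v) * `|q + a| <= (1 + v) * ((1 + v) * y + `|a|).
  by rewrite ler_wpM2l //; lra.
have v2 : v * `|q + a| <= v * ((1 + v) * y + `|a|).
  by rewrite ler_wpM2l //; lra.
have v3 : w * y <= w * (K * z) by rewrite ler_wpM2l // wE; nra.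
have v4 : (1 + v) * `|a| <= w * K * `|a|.
  by rewrite ler_wpM2r // wE; nra.
split; first by rewrite wE in v3 v4 *; lra.
rewrite wE in v3 v4 *; nra.
Qed.

(** One step of an ordinary Horner evaluation: c approximates d, and the next
    coefficient b approximates d'. The factor (1 + v) ^ 2 pays for the product
    and the sum, and also for the rounding of the coefficient and the sum. *)
Lemma horner_step v K c x d e b q c' d' D :
  0 <= v -> 1 <= K -> `|d| <= D -> `|c - d| <= (K - 1) * D -> `|d'| <= e ->
  `|q - c * x| <= v * `|c * x| -> `|b - d'| <= v * `|d'| ->
  `|c' - (q + b)| <= v * `|q + b| ->
  `|c' - (d * x + d')| <= ((1 + v) ^+ 2 * K - 1) * (D * `|x| + e).
Proof.
move=> v0 K1 hd hc hd' hq hb hc'.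
have nq := rel_err_norm hq; have nb := rel_err_norm hb.
have qb := ler_normD q b.
have nc : `|c| <= K * D.
  by have := ler_normD (c - d) d; rewrite subrK; lra.
have cx : `|c * x| <= K * (D * `|x|) by rewrite normrM mulrA ler_wpM2r.
have cdx : `|(c - d) * x| <= (K - 1) * (D * `|x|).
  by rewrite normrM mulrA ler_wpM2r.
have -> : c' - (d * x + d')
  = (c' - (q + b)) + (q - c * x) + ((c - d) * x) + (b - d') by ring.
apply: le_trans (ler_normD _ _) _.
apply: le_trans (lerD (ler_normD _ _) (lexx _)) _.
apply: le_trans (lerD (lerD (ler_normD _ _) (lexx _)) (lexx _)) _.
have D0 : 0 <= D * `|x| by rewrite mulr_ge0 // (le_trans _ hd).
have d0 := normr_ge0 d'; have cx0 := normr_ge0 (c * x).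
have v2 : v * `|q + b| <= v * ((1 + v) * `|c * x| + (1 + v) * `|d'|).
  by rewrite ler_wpM2l //; lra.
have v3 : (2 * v + v * v) * `|c * x| <= (2 * v + v * v) * (K * (D * `|x|)).
  by rewrite ler_wpM2l //; nra.
have v4 : (2 * v + v * v) * `|d'| <= (2 * v + v * v) * e.
  by rewrite ler_wpM2l //; nra.
have v5 : (1 + v) ^+ 2 * 1 * e <= (1 + v) ^+ 2 * K * e.
  by rewrite ler_wpM2r ?(le_trans d0) // ler_wpM2l // sqr_ge0.
rewrite expr2 in v5 *.
lra.
Qed.

(** 1 + u / (1 - u) is the inverse of 1 - u, and (1 - u) ^ m >= 1 - m u. *)
Lemma one_add_pow_le_gamma u m : 0 < u -> m%:R * u < 1 ->
  (1 + u / (1 - u)) ^+ m - 1 <= m%:R * u / (1 - m%:R * u).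
Proof.
move=> u0; case: m => [|m] hm; first by rewrite expr0 !mul0r subrr.
have u1 : u < 1.
  by apply: le_lt_trans hm; rewrite ler_peMl ?ler1n // ltW.
have -> : 1 + u / (1 - u) = (1 - u)^-1 by field; rewrite subr_eq0 gt_eqF.
have bern k : 1 - k%:R * u <= (1 - u) ^+ k.
  elim: k => [|k ih]; first by rewrite expr0 mul0r subr0.
  rewrite exprS -natr1.
  have : (1 - u) * (1 - k%:R * u) <= (1 - u) * (1 - u) ^+ k.
    by rewrite ler_wpM2l // subr_ge0 ltW.
  have : 0 <= k%:R * u * u by rewrite !mulr_ge0 ?ler0n ?(ltW u0).
  lra.
have d0 : 0 < 1 - m.+1%:R * u by rewrite subr_gt0.
have -> : m.+1%:R * u / (1 - m.+1%:R * u) = (1 - m.+1%:R * u)^-1 - 1.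
  by move: (m.+1%:R * u) d0 => t d0; field; rewrite gt_eqF.
by rewrite lerD2r exprVn lef_pV2 ?posrE ?exprn_gt0 ?subr_gt0.
Qed.

(** The hypothesis on the condition number, with gamma replaced by its lower
    bound 2 u and the condition number by 1. *)
Lemma unit_roundoff_small u : 0 < u ->
  2 * u * (2 * u) < (1 - u) / (2 + u) * u -> 8 * u < 1.
Proof.
move=> u0; rewrite [ltRHS]mulrAC ltr_pdivlMr; last by lra.
have -> : 2 * u * (2 * u) * (2 + u) = 4 * u * (2 + u) * u by ring.
rewrite ltr_pM2r // => h; have : 0 < u * u by rewrite mulr_gt0.
by lra.
Qed.

(** Here y is the exact value, t its approximation and f the rounding of t. The
    constant (1 - u) / (2 + u) absorbs both the passage from |y| to |t| and the
    passage from |t| to |f|. *)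
Lemma relative_error_transfer u (t y f : R) : 0 < u -> u < 1 ->
  `|f - t| <= u * `|f| -> `|y - t| < (1 - u) / (2 + u) * u * `|y| ->
  `|y - t| < u / 2 * `|f|.
Proof.
move=> u0 u1 hf; rewrite -mulrA [ltRHS]mulrAC ltr_pdivlMr; last by lra.
have hy : `|y| <= `|y - t| + (1 + u) * `|f|.
  have := ler_normD (y - t) t; rewrite subrK.
  by have := ler_normB f (f - t); rewrite subKr; lra.
have f0 := normr_ge0 f.
have h1 : (1 - u) * (u * `|y|) <= (1 - u) * (u * (`|y - t| + (1 + u) * `|f|)).
  by rewrite !ler_wpM2l //; lra.
rewrite ltNge => h2; apply/negP => h3.
have h4 : (2 + u - (1 - u) * u) * (u / 2 * `|f|)
    <= (2 + u - (1 - u) * u) * `|y - t|.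
  by rewrite ler_wpM2l //; nra.
have : 0 <= u * u * u * `|f| by rewrite !mulr_ge0 // ltW.
have : 0 <= u * u * `|f| by rewrite !mulr_ge0 // ltW.
lra.
Qed.

End Horner.

(** * The compensated algorithm *)

Lemma obind_Some (T U : Type) (e : option T) (k : T -> option U) z :
  obind k e = Some z -> exists2 t, e = Some t & k t = Some z.
Proof. by case: e => //= t h; exists t. Qed.
Arguments obind_Some {T U e k z}.

Section Algorithms.
Variables (R : realType) (A : fp_arith R).
Implicit Types (a b c f g r x y : R) (s : seq R).
Local Notation prec := (fp_prec A).
Local Notation u := (unit_roundoff A).
Local Notation float := (@float_set R prec predT).
Local Notation nearest := (@nearest R prec).
Hypothesis rnd : rounds_to_nearest A.

Lemma is_floatW f : is_float A f -> float f.
Proof.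
by case=> [->|[m [e [hm _ ->]]]]; [left | right; exists m, e; split].
Qed.

Lemma fp_resultP r f : fp_result A r = Some f -> nearest r f /\ is_float A f.
Proof.
by rewrite /fp_result; case: ifP => // /asboolP h [<-]; split=> //; exact: rnd.
Qed.

Lemma two_sumP a b x y : (1 < prec)%N -> float a -> float b ->
  two_sum A a b = Some (x, y) ->
  [/\ nearest (a + b) x, is_float A x & a + b = x + y].
Proof.
move=> prec1 fa fb; rewrite /two_sum => /obind_Some[x' /fp_resultP[hx fx]].
move=> /obind_Some[z /fp_resultP[hz _]] /obind_Some[w /fp_resultP[hw _]].
move=> /obind_Some[t /fp_resultP[ht _]] /obind_Some[v /fp_resultP[hv _]].
move=> /obind_Some[y' /fp_resultP[hy _]] [<- <-]; split=> //.
exact: (two_sum_correct prec1 fa fb hx hz hw ht hv hy).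
Qed.

Lemma veltkamp_splitP a ah al : veltkamp_split A a = Some (ah, al) ->
  split_steps prec (uphalf prec) a ah al.
Proof.
rewrite /veltkamp_split => /obind_Some[z /fp_resultP[hz _]].
move=> /obind_Some[w /fp_resultP[hw _]].
move=> /obind_Some[h /fp_resultP[hh _]] /obind_Some[l /fp_resultP[hl _]].
by move=> [<- <-]; exists z, w; split.
Qed.

Lemma two_prodP a b x y : (3 < prec)%N -> float a -> float b ->
  two_prod A a b = Some (x, y) ->
  [/\ nearest (a * b) x, is_float A x & a * b = x + y].
Proof.
move=> prec4 fa fb; rewrite /two_prod => /obind_Some[x' /fp_resultP[hx fx]].
move=> /obind_Some[[ah al] /veltkamp_splitP sa].
move=> /obind_Some[[bh bl] /veltkamp_splitP sb].
move=> /obind_Some[hh /fp_resultP[h1 _]] /obind_Some[lh /fp_resultP[h2 _]].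
move=> /obind_Some[hl /fp_resultP[h3 _]] /obind_Some[ll /fp_resultP[h4 _]].
move=> /obind_Some[e1 /fp_resultP[h5 _]] /obind_Some[e2 /fp_resultP[h6 _]].
move=> /obind_Some[e3 /fp_resultP[h7 _]] /obind_Some[y' /fp_resultP[h8 _]].
move=> [<- <-]; split=> //.
apply: (two_prod_correct prec4 fa fb sa sb hx).
by exists hh, lh, hl, ll, e1, e2, e3; split; split.
Qed.

Lemma unit_roundoff_gt0 : 0 < u.
Proof. by rewrite invr_gt0 exprn_gt0. Qed.

Local Notation v := (u / (1 - u)).

Lemma unit_roundoff_lt1 : (0 < prec)%N -> u < 1.
Proof.
by move=> prec0; rewrite invf_lt1 ?exprn_gt0 // exprn_egt1 ?ltr1n // -lt0n.
Qed.

(** From |f - r| <= u |f| one gets (1 - u) |f| <= |r|, whence the constant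
    u / (1 - u); its powers are still controlled by gamma. *)
Lemma nearest_rel_err_exact r f : (0 < prec)%N -> nearest r f ->
  `|f - r| <= v * `|r|.
Proof.
move=> prec0 hf; have := nearest_rel_err prec0 hf; rewrite -/(unit_roundoff A).
have u0 := unit_roundoff_gt0.
have u1 := unit_roundoff_lt1 prec0.
have := ler_normD (f - r) r; rewrite subrK => h1 h2.
rewrite mulrAC ler_pdivlMr ?subr_gt0 //.
have : u * `|f| <= u * (`|f - r| + `|r|) by rewrite ler_pM2l.
lra.
Qed.

Lemma rel_err_const_ge0 : (0 < prec)%N -> 0 <= v.
Proof.
move=> prec0; rewrite divr_ge0 ?(ltW unit_roundoff_gt0) // subr_ge0 ltW //.
exact: unit_roundoff_lt1.
Qed.

(** The bound on r is there for the induction: the local errors of the next step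
    are proportional to it. *)
Lemma eft_horner_correct s x r ppi psigma : (3 < prec)%N ->
  (forall a, a \in s -> float a) -> float x ->
  eft_horner A s x = Some (r, ppi, psigma) ->
  [/\ float r, size ppi = (size s).-1 /\ size psigma = (size s).-1,
    horner_rec s x = r + (horner_rec ppi x + horner_rec psigma x),
    `|r| <= (1 + v) ^+ (2 * (size s).-1) * abs_horner s x
    & abs_horner ppi x + abs_horner psigma x
      <= ((1 + v) ^+ (2 * (size s).-1) - 1) * abs_horner s x].
Proof.
move=> prec4 fs fx; have prec0 : (0 < prec)%N by apply: leq_trans prec4.
have prec1 : (1 < prec)%N by apply: leq_trans prec4.
have v0 := rel_err_const_ge0 prec0.
elim: s r ppi psigma fs => [|a [|b s] ih] r ppi psigma fs.
- move=> [<- <- <-] /=; rewrite /abs_horner /= normr0 !mulr0 !addr0.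
  by split=> //; left.
- move=> [<- <- <-] /=.
  rewrite /abs_horner /= expr0 !mul0r mul1r !add0r subrr mul0r.
  by split=> //; rewrite ?addr0 //; apply: fs; rewrite inE.
have fa : float a by apply: fs; rewrite inE eqxx.
have fs' c : c \in b :: s -> float c.
  by move=> hc; apply: fs; rewrite inE hc orbT.
have -> : eft_horner A [:: a, b & s] x =
  let? (r, ppi, psigma) := eft_horner A (b :: s) x in
  let? (q, pi_i) := two_prod A r x in
  let? (r', sigma_i) := two_sum A q a in
  Some (r', pi_i :: ppi, sigma_i :: psigma) by [].
move=> /obind_Some[[[r' ppi'] psi'] /(ih _ _ _ fs')].
have -> : (2 * (size [:: a, b & s]).-1 = 2 + 2 * (size (b :: s)).-1)%N.
  by rewrite -mulnS.
have -> : horner_rec [:: a, b & s] x = horner_rec (b :: s) x * x + a by [].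
have -> : abs_horner [:: a, b & s] x = abs_horner (b :: s) x * `|x| + `|a|.
  by [].
have -> : (size [:: a, b & s]).-1 = (size (b :: s)).-1.+1 by [].
move: (b :: s) => t [fr [sp ss] hE hr hD].
move=> /obind_Some[[q p_i] /(two_prodP prec4 fr fx)[hq fq qE]].
move=> /obind_Some[[r'' s_i] /(two_sumP prec1 (is_floatW fq) fa)[hr' fr' rE]].
move=> [<- <- <-] /=.
have piE : p_i = r' * x - q by rewrite qE; ring.
have siE : s_i = q + a - r'' by rewrite rE; ring.
have K1 : 1 <= (1 + v) ^+ (2 * (size t).-1) by rewrite exprn_ege1 // lerDl.
have [] := eft_horner_step v0 K1 hr hD (nearest_rel_err_exact prec0 hq)
  (nearest_rel_err_exact prec0 hr').
rewrite -exprD => H1 H2; split=> //.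
- exact: is_floatW.
- by rewrite sp ss.
- by rewrite hE piE siE; ring.
- apply: le_trans H2; rewrite /abs_horner /= piE siE.
  by rewrite [`|r' * x - q|]distrC [`|q + a - r''|]distrC; lra.
Qed.

Lemma horner_add_coefs_correct s1 s2 x s c : (0 < prec)%N ->
  size s1 = size s2 -> add_coefs A s1 s2 = Some s -> horner_fl A s x = Some c ->
  size s = size s1 /\
  `|c - (horner_rec s1 x + horner_rec s2 x)|
    <= ((1 + v) ^+ (2 * size s1) - 1) * (abs_horner s1 x + abs_horner s2 x).
Proof.
move=> prec0; have v0 := rel_err_const_ge0 prec0.
elim: s1 s2 s c => [|a1 s1 ih] [|a2 s2] // s c.
  move=> _ [<-] [<-]; split => //.
  by rewrite /abs_horner /= addr0 subrr normr0 mulr0.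
move=> [sz] /obind_Some[a /fp_resultP[ha _]] /obind_Some[s' hs' [<-]].
have ha' := nearest_rel_err_exact prec0 ha.
have e0 := ler_normD a1 a2.
have K1 : 1 <= (1 + v) ^+ (2 * size s1) by rewrite exprn_ege1 // lerDl.
have dE : horner_rec (a1 :: s1) x + horner_rec (a2 :: s2) x
  = (horner_rec s1 x + horner_rec s2 x) * x + (a1 + a2) by rewrite /=; ring.
have DE : abs_horner (a1 :: s1) x + abs_horner (a2 :: s2) x
  = (abs_horner s1 x + abs_horner s2 x) * `|x| + (`|a1| + `|a2|).
  by rewrite /abs_horner /=; ring.
have -> : (1 + v) ^+ (2 * size (a1 :: s1)) =
   (1 + v) ^+ 2 * (1 + v) ^+ (2 * size s1) by rewrite -exprD /= mulnS.
rewrite dE DE.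
have hd : `|horner_rec s1 x + horner_rec s2 x|
    <= abs_horner s1 x + abs_horner s2 x.
  by apply: le_trans (ler_normD _ _) _; rewrite lerD ?horner_le_abs.
case: s' hs' => [|b s'] hs' /=.
  (* The last coefficient is returned without an operation; this is a step
     with product 0 and an exact sum. *)
  move=> [<-]; have [s10 hc''] := ih _ _ 0 sz hs' erefl; rewrite -{1}s10.
  split=> //; apply: (horner_step (q := 0) v0 K1 hd hc'' e0 _ ha').
    by rewrite mul0r subrr normr0 mulr0.
  by rewrite add0r subrr normr0 mulr_ge0.
move=> /obind_Some[c' hc' /obind_Some[q /fp_resultP[hq _] /fp_resultP[hc _]]].
have [sE hc''] := ih _ _ _ sz hs' hc'.
split; first by rewrite -sE.
exact: (horner_step v0 K1 hd hc'' e0 (nearest_rel_err_exact prec0 hq) ha'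
  (nearest_rel_err_exact prec0 hc)).
Qed.

(** As r is no farther from f than from a neighbour g, it lies on the near side
    of the midpoint of f and g, and t is too close to r to reach g. *)
Lemma faithful_of_small_error f r t : is_float A f -> f != 0 -> nearest r f ->
  `|t - r| < u / 2 * `|f| -> faithful_rounding A f t.
Proof.
move=> hf f0 hr; rewrite ltr_norml => /andP[h1 h2].
have ff := is_floatW hf.
have half g : is_float A g -> g != f ->
    `|f - r| <= `|g - r| /\ u * `|f| <= `|f - g|.
  move=> /is_floatW fg gf; split; first exact: hr.2.
  by apply: float_gap; rewrite 1?eq_sym.
split=> // g [fg gf _].
- have [|d1 d2] := half g fg; first by rewrite lt_eqF.
  rewrite [leRHS]gtr0_norm ?subr_gt0 // in d2.
  have d3 := le_trans (ler_norm _) d1.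
  have [gr|rg] := leP g r.
    by rewrite [leRHS]ler0_norm ?subr_le0 // in d3; lra.
  rewrite [leRHS]gtr0_norm ?subr_gt0 // in d3; lra.
- have [|d1 d2] := half g fg; first by rewrite gt_eqF.
  rewrite [leRHS]ltr0_norm ?subr_lt0 // in d2.
  have d3 := le_trans (ler_norm (r - f)) (_ : `|r - f| <= `|g - r|).
  rewrite distrC in d3; have {}d3 := d3 d1.
  have [gr|rg] := leP r g.
    by rewrite [leRHS]ger0_norm ?subr_ge0 // in d3; lra.
  rewrite [leRHS]ltr0_norm ?subr_lt0 // in d3; lra.
Qed.

End Algorithms.

Theorem theorem7 (R : realType) (A : fp_arith R) (n : nat) (p : {poly R})
    (x r : R) (u := unit_roundoff A) :
  (1 < fp_prec A)%N ->
  rounds_to_nearest A ->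
  (1 <= n)%N -> size p = n.+1 ->
  (forall i : nat, is_float A p`_i) ->
  is_float A x ->
  p.[x] != 0 ->
  (2 * n)%:R * u < 1 ->
  cond p x < (1 - u) / (2 + u) * u * gamma A (2 * n) ^- 2 ->
  comp_horner A p x = Some r ->
  faithful_rounding A r p.[x].
Proof.
move=> prec1 rnd n1 sz fp fx px0 nu hcond hr.
have u0 : 0 < u := unit_roundoff_gt0 A.
have u1 : u < 1 := unit_roundoff_lt1 (ltnW prec1).
have px_gt0 : 0 < `|p.[x]| by rewrite normr_gt0.
set G := gamma A (2 * n) in hcond.
have hG : 2 * u <= G.
  have m2 : 2 <= (2 * n)%:R :> R by rewrite ler_nat leq_pmulr.
  have mu : 2 * u <= (2 * n)%:R * u by rewrite ler_pM2r.
  apply: le_trans mu _; rewrite ler_pdivlMr ?subr_gt0 // ler_piMr ?gerBl //.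
    by rewrite mulr_ge0 ?ler0n ?ltW.
  by rewrite mulr_ge0 ?ler0n ?ltW.
have G0 : 0 < G by rewrite (lt_le_trans _ hG) ?mulr_gt0.
have G2 : 0 < G ^+ 2 by rewrite exprn_gt0.
have hS : abs_horner p x * G ^+ 2 < (1 - u) / (2 + u) * u * `|p.[x]|.
  move: hcond; rewrite /cond -abs_hornerE ltr_pdivrMr // mulrAC.
  by rewrite ltr_pdivlMr.
(* With at most 3 bits u >= 1/8, against the bound on the condition number,
   which is at least 1. *)
have prec4 : (3 < fp_prec A)%N.
  rewrite ltnNge; apply/negP => prec3.
  have u8 : 1 <= 8 * u.
    rewrite -ler_pdivrMr // div1r invrK -[8]/(8%:R) (_ : 8 = 2 ^ 3)%N // natrX.
    by rewrite ler_eXn2l ?ltr1n.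
  have hG2 : (2 * u) * (2 * u) <= G ^+ 2.
    by rewrite expr2 ler_pM // mulr_ge0 // ltW.
  have : G ^+ 2 * `|p.[x]| < (1 - u) / (2 + u) * u * `|p.[x]|.
    by apply: le_lt_trans hS; rewrite mulrC ler_wpM2r ?horner_le_abs // ltW.
  rewrite ltr_pM2r // => /(le_lt_trans hG2) /(unit_roundoff_small u0).
  by rewrite ltNge u8.
have prec0 := ltnW prec1.
move: hr; rewrite /comp_horner => /obind_Some[[[r0 ppi] psi]].
have fs a : a \in (p : seq R) -> float_set (fp_prec A) predT a.
  by move=> /(nthP 0)[i _ <-]; exact/is_floatW/fp.
move=> /(eft_horner_correct rnd prec4 fs (is_floatW fx)).
rewrite sz /= => -[_ [s1 s2] hE _ hD].
move=> /obind_Some[q hq] /obind_Some[c hc] /(fp_resultP rnd)[hr fr].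
have [_ hc'] := horner_add_coefs_correct rnd prec0 (etrans s1 (esym s2)) hq hc.
rewrite s1 in hc'.
set C := horner_rec ppi x + horner_rec psi x in hE hc'.
have he : `|c - C| <= abs_horner p x * G ^+ 2.
  have hK := one_add_pow_le_gamma u0 nu.
  apply: le_trans hc' _; rewrite mulrC expr2 mulrA.
  have D0 : 0 <= abs_horner ppi x + abs_horner psi x.
    by rewrite addr_ge0 ?abs_horner_ge0.
  apply: le_trans (ler_wpM2l D0 hK) _; apply: ler_wpM2r; first exact: ltW.
  apply: le_trans hD _; rewrite mulrC; apply: ler_wpM2l hK.
  exact: abs_horner_ge0.
have pxE : p.[x] = r0 + C by [].
have hpr : `|p.[x] - (r0 + c)| < u / 2 * `|r|.
  have eE : p.[x] - (r0 + c) = - (c - C) by rewrite pxE; ring.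
  apply: (relative_error_transfer u0 u1 (nearest_rel_err prec0 hr)).
  by rewrite eE normrN (le_lt_trans he).
apply: (faithful_of_small_error fr _ hr hpr).
by apply: contraTneq hpr => ->; rewrite normr0 mulr0 -leNgt.
Qed.
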